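(* Let $M=(E,\mathcal{I})$ be a loopless matroid on a finite set $E$ with rank function $r$, and let $c=(c_1,\dots,c_m)$ be a sequence of integers with $m\ge 2$ and $0\le c_1<c_2<\dots<c_m\le r(E)$. Let $F\subseteq E$ with $c_p<r(F)<c_{p+1}$ for some $p\in\{1,\dots,m-1\}$. Then the rank induced forbidden set inequality $$(c_{p+1}-r(F))\,x(F)-(r(F)-c_p)\,x(E\setminus F)\le c_p\,(c_{p+1}-r(F))$$ defines a facet of $P_{\mathcal{I}}^c(E)$ if and only if (a) $c_p=c_1=0$ and the inequality $x(F)\le r(F)$ defines a facet of $P_{\mathcal{I}}^{(c_{p+1})}(E)$, or (b) $c_p>0$, $F$ is closed, and (i) $\bar F:=E\setminus F$ is $c_{p+1}$-inseparable or (ii) $c_{p+1}<r(E)$.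
   Context: A loop of a matroid is an element $e\in E$ such that $\{e\}$ is dependent; loopless means there are no loops. For $x\in\mathbb{R}^E$ and $S\subseteq E$, $x(S):=\sum_{e\in S}x_e$; $\chi^I$ denotes the incidence vector of $I\subseteq E$. $P_{\mathcal{I}}^c(E):=\operatorname{conv}\{\chi^I : I\in\mathcal{I},\ |I|=c_p \text{ for some } p\in\{1,\dots,m\}\}$, and for a single integer $k$, $P_{\mathcal{I}}^{(k)}(E):=\operatorname{conv}\{\chi^I: I\in\mathcal{I},\ |I|=k\}$. A valid inequality $ax\le a_0$ for a polytope $P$ defines a facet of $P$ if $\{x\in P: ax=a_0\}$ has dimension $\dim P-1$ (in particular, an inequality satisfied with equality on all of $P$ does not define a facet). A set $F\subseteq E$ is closed if $r(F)<r(F\cup\{e\})$ for all $e\in E\setminus F$. For a natural number $k$ and $G\subseteq E$, the $k$-rank of $G$ is $r^k(G):=k-r(E\setminus G)$. One has $r^k(G_1)+r^k(G_2)\le r^k(G)$ whenever $G$ is the disjoint union of $G_1$ and $G_2$ (for $k\le r(E)$); $G$ is $k$-separable if equality holds for some partition $G=G_1\,\dot\cup\,G_2$ with $G_1\ne\emptyset\ne G_2$, and $k$-inseparable otherwise. *)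

(* Defs.v *)
From HB Require Import structures.
From mathcomp Require Import all_boot all_order all_algebra.
From mathcomp Require Import boolp classical_sets reals.

Set Implicit Arguments.
Unset Strict Implicit.
Unset Printing Implicit Defensive.

Import Order.TTheory GRing.Theory Num.Theory.
Local Open Scope ring_scope.

Record matroid (E : finType) := Matroid {
  indep : {set {set E}};
  indep0 : finset.set0 \in indep;
  indepS : forall I J : {set E}, J \in indep -> I \subset J -> I \in indep;
  indep_aug : forall I J : {set E}, I \in indep -> J \in indep ->
    (#|I| < #|J|)%N -> exists2 e, e \in J :\: I & e |: I \in indep
}.

Definition rank (E : finType) (M : matroid E) (A : {set E}) : nat :=
  \max_(I in indep M | I \subset A) #|I|.

Definition is_loop (E : finType) (M : matroid E) (e : E) : bool :=
  [set e] \notin indep M.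

Definition loopless (E : finType) (M : matroid E) : Prop :=
  forall e : E, ~~ is_loop M e.

Definition closed_set (E : finType) (M : matroid E) (F : {set E}) : Prop :=
  forall e : E, e \notin F -> (rank M F < rank M (e |: F))%N.

(* Integer-valued: k may be smaller than the rank of E \ G. *)
Definition krank (E : finType) (M : matroid E) (k : nat) (G : {set E}) : int :=
  k%:Z - (rank M (~: G))%:Z.

Definition kseparable (E : finType) (M : matroid E) (k : nat) (G : {set E}) :
    Prop :=
  exists G1 G2 : {set E},
    [/\ G1 :|: G2 = G, [disjoint G1 & G2],
        G1 != finset.set0, G2 != finset.set0
      & krank M k G1 + krank M k G2 = krank M k G].

Definition kinseparable (E : finType) (M : matroid E) (k : nat) (G : {set E}) :
    Prop :=
  ~ kseparable M k G.

Section Polytopes.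
Variables (R : realType) (E : finType).

(* R^E; the regular module R^o on the coefficients provides the vector space
   structure. *)
Local Notation vect := {ffun E -> R^o}.

Implicit Types (P S : set vect) (x : vect).

Definition coord_sum x (A : {set E}) : R := \sum_(e in A) x e.

Definition chi (I : {set E}) : vect := [ffun e => (e \in I)%:R].

Definition conv S : set vect :=
  fun x => exists (n : nat) (t : 'I_n -> vect) (w : 'I_n -> R),
    [/\ forall i, S (t i), forall i, 0 <= w i,
        \sum_i w i = 1 & x = \sum_i w i *: t i].

Definition affinely_independent (n : nat) (t : 'I_n -> vect) : Prop :=
  forall w : 'I_n -> R,
    \sum_i w i = 0 -> \sum_i w i *: t i = 0 -> forall i, w i = 0.

(* The maximal number of affinely independent points of P, minus one; hence
   -1 for the empty set.  The range of the maximum loses nothing, since at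
   most #|E| + 1 points of R^E are affinely independent. *)
Definition affine_dim P : int :=
  (\max_(n < #|E|.+2 |
     `[< exists t : 'I_n -> vect,
           affinely_independent t /\ forall i, P (t i) >]) n)%N%:Z - 1.

(* f is meant to be a linear form on R^E. *)
Definition defines_facet P (f : vect -> R) (b : R) : Prop :=
  (forall x, P x -> f x <= b) /\
  affine_dim (fun x => P x /\ f x = b) = affine_dim P - 1.

Variable M : matroid E.

Definition card_constrained_polytope (c : seq nat) : set vect :=
  conv (fun x => exists I : {set E},
    [/\ I \in indep M, #|I| \in c & x = chi I]).

Definition uniform_card_polytope (k : nat) : set vect :=
  conv (fun x => exists I : {set E},
    [/\ I \in indep M, #|I| = k & x = chi I]).

End Polytopes.

Arguments card_constrained_polytope R {E} M c.
Arguments uniform_card_polytope R {E} M k.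

(* Main.v *)
Require Import Defs.
From HB Require Import structures.
From mathcomp Require Import all_boot all_order all_algebra.
From mathcomp Require Import boolp classical_sets reals.
From mathcomp Require Import zify.

Set Implicit Arguments.
Unset Strict Implicit.
Unset Printing Implicit Defensive.

Import Order.TTheory GRing.Theory Num.Theory.
Local Open Scope ring_scope.

(** Write [r] for the rank of [F] and [cp < r < cq] for the two consecutive
    cardinalities around it.  For an independent set [I] with [i] elements in
    [F] and [j] outside, the slack of the inequality is
    [(cq - r) * (cp - i) + (r - cp) * j].  If [#|I| <= cp] both terms are
    nonnegative.  If [#|I| >= cq] then [i <= r] and [j >= cq - i], so the slack is
    at least [(cq - cp) * (r - i)].  So the inequality is valid, and the tight vertices are the independent sets
    contained in [F] of size [cp] together with the independent sets of size
    [cq] that contain a basis of [F] ([tight_feasible]).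

    Dimensions are counted linearly.  Lifting [x] to [(x, 1)] turns the affine
    dimension of a polytope into the dimension, minus one, of the span of its
    lifted vertices, and a face of a polytope is spanned by its tight vertices.
    Hence the inequality defines a facet exactly when the lifted tight vertices
    span a subspace of codimension one in the span of all lifted vertices
    ([defines_facetE]).

    Whether a span [W] is large is decided by basis exchange.  If two sets of
    the family differ by an exchange of [e] for [f], then [W] contains the
    difference of the unit vectors of [e] and [f].  Being related in this way is
    an equivalence on the ground set, and a union [D] of classes meets all
    members of the family in the same number of elements, because any two
    members are joined by exchanges.  Comparing a member that is large on [D]
    with one that is large on the complement shows that [D] separates the
    underlying minor, and that no truncation took place
    ([exchange_closed_split]).  So for a loopless minor that is properly
    truncated or connected, all differences lie in [W] ([fiber_parallel]).

    If [cp > 0], the independent sets of size [cp] are the bases of a proper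
    truncation, both in [M] and in [M] restricted to [F].  The first fact makes the polytope full-dimensional.  The
    second gives all differences inside [F]; when [F] is closed and its
    complement is inseparable or [cq] is below the rank of [M], the minor [M / F]
    gives all differences outside [F], and then the tight vertices span a
    hyperplane ([facet_sufficient]).  Conversely an element [e] outside [F] in
    its closure, or a separation of the complement of [F], produces a second
    independent equation satisfied by all tight vertices ([facet_necessary]).

    If [cp = 0], the tight vertices are the origin and those tight vertices that
    lie on the slice of cardinality [cq]; adding the origin raises by one both
    the dimension of the slice and that of its face, so the inequality defines a
    facet of the whole polytope iff [x(F) <= r] defines one of the slice
    ([dim_feasible0], [dim_tight0]). *)

(** * Rank and basis exchange in a minor *)

Section Matroid.
Import fintype boot.finset.
Local Open Scope nat_scope.
Variables (E : finType) (M : matroid E).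
Implicit Types (A B D F G I J : {set E}) (e f : E) (k : nat).

Lemma indep_leq_rank A I : I \in indep M -> I \subset A -> #|I| <= rank M A.
Proof. by move=> hI IA; apply: leq_bigmax_cond; rewrite hI IA. Qed.

Lemma cardI_leq_rank A I : I \in indep M -> #|I :&: A| <= rank M A.
Proof.
move=> hI; apply: indep_leq_rank; last exact: subsetIr.
exact: indepS hI (subsetIl _ _).
Qed.

Lemma rankS A B : A \subset B -> rank M A <= rank M B.
Proof.
move=> AB; apply/bigmax_leqP => I /andP[hI IA].
exact: indep_leq_rank hI (subset_trans IA AB).
Qed.

Lemma rank0 : rank M finset.set0 = 0.
Proof.
apply/eqP; rewrite -leqn0; apply/bigmax_leqP => I /andP[_].
by rewrite subset0 => /eqP->; rewrite cards0.
Qed.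

Lemma exists_basis A :
  exists I : {set E}, [/\ I \in indep M, I \subset A & #|I| = rank M A].
Proof.
have P0 : (finset.set0 \in indep M) && (finset.set0 \subset A).
  by rewrite indep0 sub0set.
rewrite /rank (bigop.bigmax_eq_arg (P := fun I => (I \in indep M) && (I \subset A)) _ P0).
by case: arg_maxnP => // I /andP[hI IA] _; exists I.
Qed.

Lemma indep_extend A I k :
    I \in indep M -> I \subset A -> #|I| <= k <= rank M A ->
  exists J : {set E}, [/\ J \in indep M, I \subset J, J \subset A & #|J| = k].
Proof.
move=> hI IA /andP[]; elim: k => [|k IHk] Ik kA.
  by exists I; split=> //; apply/eqP; rewrite -leqn0.
have [Ik1 | Ik1] := eqVneq #|I| k.+1; first by exists I; split.
have [|J [hJ IJ JA cJ]] := IHk _ (ltnW kA); first by lia.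
have [B [hB BA cB]] := exists_basis A.
have [|e /setDP[eB eJ] heJ] := indep_aug hJ hB; first by lia.
exists (e |: J); split=> //.
- exact: subset_trans IJ (subsetUr _ _).
- by rewrite subUset sub1set (subsetP BA).
- by rewrite cardsU1 eJ cJ.
Qed.

Lemma rank_submod A B :
  rank M (A :|: B) + rank M (A :&: B) <= rank M A + rank M B.
Proof.
have [I [hI IAB cI]] := exists_basis (A :&: B).
have IU : I \subset A :|: B.
  by apply: subset_trans IAB _; apply: subset_trans (subsetIl _ _) (subsetUl _ _).
have [|J [hJ IJ JU cJ]] := @indep_extend _ _ (rank M (A :|: B)) hI IU.
  by rewrite leqnn andbT; apply: indep_leq_rank.
have hA := cardI_leq_rank A hJ; have hB := cardI_leq_rank B hJ.
have hU : #|J :&: A :|: J :&: B| = rank M (A :|: B).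
  by rewrite -setIUr (setIidPl JU).
have hIn : #|I| <= #|(J :&: A) :&: (J :&: B)|.
  by rewrite -setIIr; apply: subset_leq_card; rewrite subsetI IJ.
have := cardsUI (J :&: A) (J :&: B); lia.
Qed.

Lemma setC_part F D D' :
  D :|: D' = ~: F -> [disjoint D & D'] -> ~: D = F :|: D'.
Proof.
move=> /setP DD' disj; apply/setP => x; have := DD' x; rewrite !inE.
case: (boolP (x \in D)) => [xD|_] /=; first by rewrite (disjointFr disj xD); case: (x \in F).
by move=> ->; rewrite orbN.
Qed.

Lemma cardsI_disjointU I A B : [disjoint B & A] ->
  #|I :&: (A :|: B)| = #|I :&: A| + #|I :&: B|.
Proof.
move=> AB; rewrite setIUr -cardsUI.
suff -> : I :&: A :&: (I :&: B) = finset.set0 by rewrite cards0 addn0.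
apply/setP => x; rewrite !inE; case: (boolP (x \in B)) => xB; rewrite ?andbF //.
by rewrite (disjointFr AB xB) !andbF.
Qed.

(** For [F \subset G] these are, up to a basis of [F], the independent sets of
    size [k - rank M F] of the minor [M | G / F]. Every face met below is the
    hull of one or two such families. *)
Definition fiber F G k : {set {set E}} :=
  [set I in indep M | [&& I \subset G, #|I| == k & #|I :&: F| == rank M F]].

Lemma fiberP F G k I :
  reflect [/\ I \in indep M, I \subset G, #|I| = k & #|I :&: F| = rank M F]
          (I \in fiber F G k).
Proof.
rewrite inE; apply: (iffP and4P) => [[-> -> /eqP-> /eqP->]|[-> -> -> ->]] //.
Qed.

(** Grow a basis of [F] first inside [D], then inside [G]. *)
Lemma fiber_extend F G D k : F \subset D -> D \subset G ->
    rank M F <= k <= rank M G ->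
  exists2 B, B \in fiber F G k & #|B :&: D| = minn k (rank M D).
Proof.
move=> FD DG /andP[Fk kG].
have [I [hI IF cI]] := exists_basis F.
have FrD := rankS FD; have DrG := rankS DG.
have [|J [hJ IJ JD cJ]] :=
    @indep_extend D I (minn k (rank M D)) hI (subset_trans IF FD).
  by rewrite cI; lia.
have [|B [hB JB BG cB]] := @indep_extend G J k hJ (subset_trans JD DG).
  by rewrite cJ; lia.
exists B.
  apply/fiberP; split=> //; apply/eqP; rewrite eqn_leq cardI_leq_rank //= -cI.
  by apply: subset_leq_card; rewrite subsetI IF (subset_trans IJ).
apply/eqP; rewrite eqn_leq leq_min cardI_leq_rank // andbT -{1}cB.
rewrite subset_leq_card ?subsetIl //= -cJ; apply: subset_leq_card.
by rewrite subsetI JB.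
Qed.

Lemma exists_fiber D G k : D \subset G -> (rank M D <= k <= rank M G)%N ->
  exists I, I \in fiber D G k.
Proof. by move=> DG kG; have [I hI _] := fiber_extend DG (subxx G) kG; exists I. Qed.

(** Augmenting [B :\ e] from [B'] cannot pick an element of [F], because [B]
    already contains a basis of [F]; so the exchange stays in the family. *)
Lemma fiber_exchange F G k B B' e :
    B \in fiber F G k -> B' \in fiber F G k -> e \in (B :\: B') :\: F ->
  exists2 f, f \in (B' :\: B) :\: F & f |: (B :\ e) \in fiber F G k.
Proof.
move=> /fiberP[hB BG cB rB] /fiberP[hB' B'G cB' rB'].
rewrite !inE => /and3P[eF eB' eB].
have cBe : #|B :\ e| < #|B'| by rewrite cB' -cB [#|B|](cardsD1 e) eB.
have [f /setDP[fB' fBe] hf] := indep_aug (indepS hB (subsetDl _ _)) hB' cBe.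
have fe : f != e by apply: contraNneq eB' => <-.
have fB : f \notin B by move: fBe; rewrite !inE fe.
have trace : (B :\ e) :&: F = B :&: F.
  by apply/setP => x; rewrite !inE; case: eqVneq eF => [->|] //=; case: (e \in F); rewrite ?andbF.
have fF : f \notin F.
  apply/negP => fF.
  have := cardI_leq_rank F hf; rewrite setIUl trace.
  have /setIidPl-> : [set f] \subset F by rewrite sub1set.
  by rewrite cardsU1 rB !inE (negbTE fB) /= ltnn.
exists f; first by rewrite !inE fF fB fB'.
apply/fiberP; split=> //.
- by rewrite subUset sub1set (subsetP B'G) //= (subset_trans (subsetDl _ _)).
- by rewrite cardsU1 fBe -cB [in RHS](cardsD1 e) eB.
- rewrite setIUl trace -rB.
  suff -> : [set f] :&: F = finset.set0 by rewrite set0U.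
  by apply/setP => x; rewrite !inE; case: eqVneq => // ->; rewrite (negbTE fF).
Qed.

(** Only exchanges outside [F] are constrained: members of the family are joined
    by exchanges of this kind. *)
Definition exchange_closed F G k D :=
  forall B e f, B \in fiber F G k -> e \in B -> f \notin B ->
    e \notin F -> f \notin F -> f |: (B :\ e) \in fiber F G k ->
  (e \in D) = (f \in D).

(** Any two members of the family are joined by a sequence of exchanges, and
    none of these changes the trace size on [D]. *)
Lemma exchange_closed_card F G k D B B' :
    [disjoint D & F] -> exchange_closed F G k D ->
    B \in fiber F G k -> B' \in fiber F G k ->
  #|B :&: D| = #|B' :&: D|.
Proof.
move=> DF closedD; have [n] := ubnP #|(B :\: B') :\: F|.
elim: n B => // n IHn B ltn hB hB'.
have [B0 | [e eB]] := set_0Vmem ((B :\: B') :\: F).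
  have /fiberP[_ _ cB rB] := hB; have /fiberP[_ _ cB' rB'] := hB'.
  (* Both sets have the same size outside F, so an inclusion is an equality. *)
  have eqDF : B :\: F = B' :\: F.
    apply/eqP; rewrite eqEcard; apply/andP; split.
      apply/subsetP => x /setDP[xB xF]; rewrite inE xF /=.
      apply: contraT => xB'; have : x \in (B :\: B') :\: F by rewrite !inE xF xB xB'.
      by rewrite B0 inE.
    by rewrite !cardsD cB cB' rB rB'.
  have trD (C : {set E}) : C :&: D = (C :\: F) :&: D.
    apply/setP => x; rewrite !inE; case: (boolP (x \in D)) => xD; rewrite ?andbF ?andbT //.
    by rewrite (disjointFr DF xD).
  by rewrite trD eqDF -trD.
have [f fB hBf] := fiber_exchange hB hB' eB.
rewrite -(IHn _ _ hBf hB').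
  move: eB fB; rewrite !inE => /and3P[eF eB' eB] /and3P[fF fB fB'].
  have eqD := closedD B e f hB eB fB eF fF hBf.
  have -> : (f |: (B :\ e)) :&: D = if e \in D then f |: ((B :&: D) :\ e) else B :&: D.
    apply/setP => x; case: ifP eqD => eD fD; rewrite !inE.
      case: (eqVneq x f) => [->|_] /=; first by rewrite -fD.
      by rewrite andbA.
    case: (eqVneq x f) => [->|_] /=; first by rewrite -fD andbF.
    by case: (eqVneq x e) => [->|] //=; rewrite eD andbF.
  case: ifP => // eD; rewrite cardsU1 !inE (negbTE fB) andbF /=.
  by rewrite [in LHS](cardsD1 e) !inE eB eD.
rewrite -ltnS; apply: leq_ltn_trans ltn; apply: proper_card; apply/properP.
split; last first.
  exists e => //; move: eB fB; rewrite !inE => /and3P[-> -> eB] /and3P[_ fB _].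
  by rewrite eqxx /= orbF; apply: contraNneq fB => <-.
apply/subsetP => x; move: fB; rewrite !inE => /and3P[_ _ fB'].
case: (eqVneq x f) => [-> | _] /=; first by rewrite fB' andbF.
by move=> /and4P[-> -> _ ->].
Qed.

(** A member that is as large as possible on [F :|: D] and one that is as large
    as possible on [F :|: D'] have the same number of elements in [D].  Comparing
    the two counts gives
    [minn k (rank (F :|: D)) + minn k (rank (F :|: D')) = k + rank F].  As both
    ranks exceed that of [F], neither minimum is [k], and submodularity leaves
    room only for [k = rank G]. *)
Lemma exchange_closed_split F G k D D' :
    F \subset G -> [disjoint D & D'] -> D :|: D' = G :\: F ->
    rank M F < k <= rank M G ->
    rank M F < rank M (F :|: D) -> rank M F < rank M (F :|: D') ->
    exchange_closed F G k D ->
  k = rank M G /\ rank M (F :|: D) + rank M (F :|: D') = k + rank M F.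
Proof.
move=> FG DD' DDG /andP[Fk kG] rD rD' closedD.
have DGF : D \subset G :\: F by rewrite -DDG subsetUl.
have D'GF : D' \subset G :\: F by rewrite -DDG subsetUr.
have DF : [disjoint D & F] by have := DGF; rewrite subsetD => /andP[].
have D'F : [disjoint D' & F] by have := D'GF; rewrite subsetD => /andP[].
have DG : D \subset G by have := DGF; rewrite subsetD => /andP[].
have D'G : D' \subset G by have := D'GF; rewrite subsetD => /andP[].
have FkG : rank M F <= k <= rank M G by rewrite ltnW.
have [|B hB cB] := @fiber_extend F G (F :|: D) k (subsetUl _ _) _ FkG.
  by rewrite subUset FG.
have [|B' hB' cB'] := @fiber_extend F G (F :|: D') k (subsetUl _ _) _ FkG.
  by rewrite subUset FG.
have eqD := exchange_closed_card DF closedD hB hB'.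
have /fiberP[_ _ kB rB] := hB; have /fiberP[_ B'sG kB' rB'] := hB'.
have GE : G = F :|: (D :|: D').
  by rewrite DDG; apply/setP => x; rewrite !inE; have := subsetP FG x; case: (x \in F) => // ->.
have kE : #|B' :&: G| = rank M F + #|B' :&: D| + #|B' :&: D'|.
  rewrite GE cardsI_disjointU; last
    by rewrite DDG disjoint_sym disjoints_subset setDE setCI setCK subsetUr.
  by rewrite cardsI_disjointU 1?disjoint_sym // rB' addnA.
move: cB cB' kE; rewrite !cardsI_disjointU // rB rB' (setIidPl B'sG) kB'.
have := rank_submod (F :|: D) (F :|: D').
have -> : (F :|: D) :|: (F :|: D') = G by rewrite -setUUr.
have -> : (F :|: D) :&: (F :|: D') = F.
  by rewrite -setUIr (eqP (_ : D :&: D' == finset.set0)) ?setU0 // setI_eq0.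
lia.
Qed.

End Matroid.

(** * Dimensions of vertex-generated polytopes *)

Section Homogenize.
Import fintype boot.finset.
Variables (R : realType) (E : finType).
Local Notation vect := {ffun E -> R^o}.
Local Notation hvect := (vect * R^o)%type.
Implicit Types (A : {set {set E}}) (I J : {set E}) (e f : E) (k : nat).
Implicit Types (U W : {vspace hvect}) (a : E -> R) (b : R).

(** Affine statements about [R^E] become linear in [R^E * R], where the point [x]
    is lifted to [(x, 1)]. *)
Definition unitv e : hvect := (chi R [set e], 0).
Definition apex : hvect := (0, 1).
Definition vertex I : hvect := (chi R I, 1).

Lemma vertexE I : vertex I = \sum_(e in I) unitv e + apex.
Proof.
have sum1 : (\sum_(e in I) unitv e).1 = chi R I.
  rewrite (raddf_sum (@fst vect R^o)) /=; apply/ffunP => x.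
  rewrite sum_ffunE !ffunE; case: (boolP (x \in I)) => xI.
    rewrite (bigD1 x) //= ffunE set11 big1 ?addr0 // => i /andP[_ ix].
    by rewrite ffunE inE eq_sym (negbTE ix).
  rewrite big1 // => i iI; rewrite ffunE inE; case: eqVneq => // xi.
  by rewrite xi iI in xI.
have sum2 : (\sum_(e in I) unitv e).2 = 0.
  by rewrite (raddf_sum (@snd vect R^o)) /= big1.
by rewrite /vertex /apex [\sum_(e in I) _]surjective_pairing sum1 sum2 -[RHS]/(_, _) /= addr0 add0r.
Qed.

Lemma dim_hvect : \dim {:hvect} = #|E|.+1.
Proof. by rewrite dimvf [LHS](_ : _ = #|E| * 1 + 1)%N // muln1 addn1. Qed.

Lemma unitv_full W : (forall e, unitv e \in W) -> apex \in W -> W = fullv.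
Proof.
move=> hu ha; apply/eqP; rewrite eqEsubv subvf /=; apply/subvP => v _.
have -> : v = \sum_e v.1 e *: unitv e + v.2 *: apex.
  rewrite [LHS]surjective_pairing [RHS]surjective_pairing; congr (_, _).
    rewrite (raddfD (@fst vect R^o)) (raddf_sum (@fst vect R^o)) /= scaler0 addr0.
    apply/ffunP => x; rewrite sum_ffunE (bigD1 x) //= !ffunE set11 /GRing.scale /= mulr1.
    by rewrite big1 ?addr0 // => i ix; rewrite !ffunE inE eq_sym (negbTE ix) /GRing.scale /= mulr0.
  rewrite (raddfD (@snd vect R^o)) (raddf_sum (@snd vect R^o)) /=.
  by rewrite big1 ?add0r => [|i _]; rewrite /= ?scaler0 // /GRing.scale /= mulr1.
by apply: rpredD; [apply: rpred_sum => e _|]; apply: rpredZ.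
Qed.

Definition vspan A : {vspace hvect} := <<(map vertex (enum A))>>%VS.

Lemma mem_vspan A I : I \in A -> vertex I \in vspan A.
Proof. by move=> IA; apply/memv_span/map_f; rewrite mem_enum. Qed.

Lemma vspan_subP A W :
  reflect (forall I, I \in A -> vertex I \in W) (vspan A <= W)%VS.
Proof.
apply: (iffP span_subvP) => [h I IA|h v /mapP[I]].
  by apply/h/map_f; rewrite mem_enum.
by rewrite mem_enum => IA ->; apply: h.
Qed.

Lemma vspanS (A B : {set {set E}}) : A \subset B -> (vspan A <= vspan B)%VS.
Proof. by move=> /subsetP AB; apply/vspan_subP => I /AB; apply: mem_vspan. Qed.

Lemma vertex0 : vertex finset.set0 = apex.
Proof. by rewrite vertexE big_set0 add0r. Qed.

Lemma vspan_set0U A :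
  vspan (finset.set0 |: A) = (vspan A + <[apex]>)%VS.
Proof.
apply/eqP; rewrite eqEsubv subv_add -memvE -vertex0 mem_vspan ?setU11 //.
rewrite vspanS ?subsetUr // !andbT; apply/vspan_subP => I /setU1P[->|IA].
  by rewrite memvE addvSr.
by apply: subvP (mem_vspan IA); apply: addvSl.
Qed.

(** The affine functional [x |-> a x + b], as a linear form on lifted points. *)
Definition lform a b (v : hvect) : R^o := \sum_e a e * v.1 e + b * v.2.

Lemma lform_is_linear a b : linear (lform a b).
Proof.
move=> k u v; rewrite /lform /= mulrDr scalerDr addrACA scaler_sumr -big_split /=.
congr (_ + _); last by rewrite /GRing.scale /= mulrCA.
by apply: eq_bigr => e _; rewrite !ffunE mulrDr /GRing.scale /= mulrCA.
Qed.

HB.instance Definition _ a b :=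
  GRing.isLinear.Build R hvect R^o *:%R (lform a b) (lform_is_linear a b).

Lemma lform_sub a b U v :
  (U <= lker (linfun (lform a b)))%VS -> v \in U -> lform a b v = 0.
Proof. by move=> /subvP Uk /Uk; rewrite memv_ker lfunE => /eqP. Qed.

Lemma sum_chi a I : \sum_e a e * (chi R I e) = \sum_(e in I) a e.
Proof.
rewrite [RHS]big_mkcond; apply: eq_bigr => e _; rewrite ffunE.
by case: (e \in I); rewrite ?mulr1 ?mulr0.
Qed.

Lemma lform_vertex a b I : lform a b (vertex I) = \sum_(e in I) a e + b.
Proof. by rewrite /lform /= sum_chi mulr1. Qed.

Lemma lform_unitv a b e : lform a b (unitv e) = a e.
Proof. by rewrite /lform /= sum_chi big_set1 mulr0 addr0. Qed.

Lemma lform_apex a b : lform a b apex = b.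
Proof. by rewrite /lform /= mulr1 big1 ?add0r // => e _; rewrite ffunE mulr0. Qed.

Lemma vspan_kerP a b A :
  reflect (forall I, I \in A -> \sum_(e in I) a e + b = 0)
          (vspan A <= lker (linfun (lform a b)))%VS.
Proof.
apply: (iffP (vspan_subP _ _)) => h I /h; rewrite memv_ker lfunE /= lform_vertex.
  by move/eqP.
by move/eqP.
Qed.

(** All lifted vertices satisfy [x(E) = k * t], which fails at [(0, 1)]. *)
Lemma apex_notin A k : (0 < k)%N -> (forall I, I \in A -> #|I| = k) ->
  apex \notin vspan A.
Proof.
move=> k0 Ak; apply/negP => /(@lform_sub (fun=> 1) (- k%:R)) h.
have /eqP : lform (fun=> 1) (- k%:R) (apex) = 0.
  by apply: h; apply/vspan_kerP => I /Ak Ik; rewrite sumr_const Ik subrr.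
by rewrite lform_apex oppr_eq0 pnatr_eq0 gtn_eqF.
Qed.

Lemma dim_add_line U v : v \notin U -> \dim (U + <[v]>)%VS = (\dim U).+1.
Proof.
move=> vU; have v0 : v != 0 by apply: contraNneq vU => ->; apply: rpred0.
rewrite dimv_disjoint_sum ?dim_vline ?v0 ?addn1 //.
apply/eqP; rewrite -subv0; apply/subvP => x; rewrite memv_cap memv0.
move=> /andP[xU /vlineP[k xk]]; move: xU; rewrite xk rpredZeq (negbTE vU) orbF.
by move=> /eqP->; rewrite scale0r.
Qed.

Lemma span_free_sub (X : seq hvect) :
  exists Y : seq hvect, [/\ {subset Y <= X}, free Y & <<Y>>%VS = <<X>>%VS].
Proof.
elim: X => [|v X [Y [YX fY sY]]]; first by exists [::]; rewrite nil_free.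
have [vX|vX] := boolP (v \in <<X>>%VS).
  exists Y; split=> // [y /YX yX|]; first by rewrite inE yX orbT.
  rewrite span_cons sY; apply/eqP; rewrite eqEsubv addvSr /= subv_add subvv andbT.
  by rewrite -memvE.
exists (v :: Y); split; first by move=> y; rewrite !inE => /orP[->|/YX ->]; rewrite ?orbT.
  by rewrite free_cons sY vX.
by rewrite !span_cons sY.
Qed.

(** Points are affinely independent iff their lifts are linearly independent, so
    the largest affinely independent family in [P] lifts to a basis of [U]. *)
Lemma affine_dimE (P : set vect) U (X : seq hvect) :
    (forall x, P x -> (x, 1) \in U) -> <<X>>%VS = U ->
    (forall v, v \in X -> exists2 x, P x & v = (x, 1)) ->
  affine_dim P = (\dim U)%:Z - 1.
Proof.
move=> PU sX XP; congr (Posz _ - 1); apply/eqP; rewrite eqn_leq; apply/andP; split.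
  apply/bigmax_leqP => n /asboolP[t [tind tP]].
  pose T := [tuple ((t i, 1) : hvect) | i < n].
  have Ti (i : 'I_n) : T`_i = (t i, 1) by rewrite (nth_map i) ?size_enum_ord // nth_ord_enum.
  have fT : free T.
    apply/freeP => k; rewrite (eq_bigr (fun i => k i *: (t i, 1))); last by move=> i _; rewrite Ti.
    move=> k0; apply: tind.
      move/(congr1 snd): k0; rewrite (raddf_sum (@snd vect R^o)) /= => k0.
      by rewrite -[RHS]k0; apply: eq_bigr => i _; rewrite /GRing.scale /= mulr1.
    by move/(congr1 fst): k0; rewrite (raddf_sum (@fst vect R^o)).
  have sT : (<<T>> <= U)%VS.
    by apply/span_subvP => v /mapP[i _ ->]; apply: PU.
  by have := dimvS sT; rewrite (eqP fT) size_tuple.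
have [Y [YX fY sY]] := span_free_sub X.
have ltd : (\dim U < #|E|.+2)%N by rewrite ltnS -dim_hvect dimvS ?subvf.
have szY : \dim U = size Y by rewrite -sX -sY (eqP fY).
rewrite szY in ltd *.
apply: (leq_bigmax_cond (Ordinal ltd)); apply/asboolP => /=.
have YP (i : 'I_(size Y)) : exists2 x, P x & Y`_i = (x, 1).
  by apply/XP/YX/mem_nth.
exists (fun i => (Y`_i).1); split=> [w w0 wt|i]; last by have [x Px ->] := YP i.
move: fY; rewrite -[Y]/(tval (in_tuple Y)) => /freeP; apply.
rewrite [LHS]surjective_pairing (raddf_sum (@fst vect R^o)) (raddf_sum (@snd vect R^o)) /=.
rewrite wt -[RHS]/(0, 0); congr (_, _); rewrite -[RHS]w0; apply: eq_bigr => i _.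
by have [x _ ->] := YP i; rewrite /GRing.scale /= mulr1.
Qed.

Lemma mem_conv_span U n (t : 'I_n -> vect) (w : 'I_n -> R) :
    \sum_i w i = 1 -> (forall i, w i != 0 -> (t i, 1) \in U) ->
  (\sum_i w i *: t i, 1) \in U.
Proof.
move=> w1 tU.
have -> : (\sum_i w i *: t i, 1) = \sum_i w i *: ((t i, 1) : hvect).
  rewrite [RHS]surjective_pairing (raddf_sum (@fst vect R^o)) (raddf_sum (@snd vect R^o)) /=.
  by congr (_, _); rewrite -[LHS]w1; apply: eq_bigr => i _; rewrite /GRing.scale /= mulr1.
apply: rpred_sum => i _; have [->|wi] := eqVneq (w i) 0; first by rewrite scale0r rpred0.
exact/rpredZ/tU.
Qed.

Definition tight A a b : {set {set E}} := [set I in A | \sum_(e in I) a e == b].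

Lemma tight_ker A a b :
  (vspan (tight A a b) <= lker (linfun (lform a (- b))))%VS.
Proof. by apply/vspan_kerP => I; rewrite inE => /andP[_ /eqP->]; rewrite subrr. Qed.

Lemma conv_incl (S : set vect) x : S x -> conv S x.
Proof.
move=> Sx; exists 1%N, (fun=> x), (fun=> 1); split=> //.
  by rewrite big_ord1.
by rewrite big_ord1 scale1r.
Qed.

Section Facet.
Variables (S : set vect) (A : {set {set E}}).
Hypothesis S_A : forall x, S x <-> exists2 I, I \in A & x = chi R I.

Lemma affine_dim_conv : affine_dim (conv S) = (\dim (vspan A))%:Z - 1.
Proof.
apply: (@affine_dimE _ _ (map vertex (enum A))) => //.
  move=> x [n [t [w [St _ w1 ->]]]]; apply: mem_conv_span => // i _.
  by have /S_A[I IA ->] := St i; apply: mem_vspan.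
move=> v /mapP[I]; rewrite mem_enum => IA ->.
by exists (chi R I) => //; apply/conv_incl/S_A; exists I.
Qed.

Variables (f : vect -> R) (a : E -> R) (b : R).
Hypothesis fE : forall x, f x = \sum_e a e * x e.
Hypothesis valid : forall I, I \in A -> \sum_(e in I) a e <= b.

Lemma f_conv n (t : 'I_n -> vect) (w : 'I_n -> R) :
  f (\sum_i w i *: t i) = \sum_i w i * f (t i).
Proof.
rewrite fE (eq_bigr (fun e => \sum_i w i * (a e * t i e))); last first.
  move=> e _; rewrite sum_ffunE mulr_sumr; apply: eq_bigr => i _.
  by rewrite ffunE /GRing.scale /= mulrCA.
by rewrite exchange_big; apply: eq_bigr => i _ /=; rewrite fE mulr_sumr.
Qed.

Lemma f_vertex_le x : S x -> f x <= b.
Proof. by move=> /S_A[I IA ->]; rewrite fE sum_chi valid. Qed.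

Lemma conv_valid x : conv S x -> f x <= b.
Proof.
move=> [n [t [w [St w0 w1 ->]]]]; rewrite f_conv -[b]mul1r -w1 mulr_suml.
by apply: ler_sum => i _; apply: ler_wpM2l => //; apply: f_vertex_le.
Qed.

(** A convex combination attains the bound only if every point carrying a
    positive weight does, so the face is spanned by its vertices. *)
Lemma affine_dim_face :
  affine_dim (fun x => conv S x /\ f x = b) = (\dim (vspan (tight A a b)))%:Z - 1.
Proof.
apply: (@affine_dimE _ _ (map vertex (enum (tight A a b)))) => //.
  move=> x [[n [t [w [St w0 w1 ->]]]]]; rewrite f_conv => fb.
  have slack i : 0 <= w i * (b - f (t i)).
    by rewrite mulr_ge0 // subr_ge0 f_vertex_le.
  have : \sum_i w i * (b - f (t i)) = 0.
    under eq_bigr do rewrite mulrBr.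
    by rewrite sumrB fb -mulr_suml w1 mul1r subrr.
  move/eqP; rewrite psumr_eq0 // => /allP s0; apply: mem_conv_span => // i wi.
  have /S_A[I IA tI] := St i; rewrite tI; apply: mem_vspan.
  rewrite inE IA /= -sum_chi -fE -tI eq_sym -subr_eq0.
  by have := s0 i (mem_index_enum _); rewrite mulf_eq0 (negbTE wi).
move=> v /mapP[I]; rewrite mem_enum inE => /andP[IA /eqP Ib] ->.
exists (chi R I) => //; split; last by rewrite fE sum_chi.
by apply/conv_incl/S_A; exists I.
Qed.

Lemma defines_facetE :
  defines_facet (conv S) f b <->
  \dim (vspan A) = (\dim (vspan (tight A a b))).+1.
Proof.
rewrite /defines_facet affine_dim_conv affine_dim_face.
split=> [[_]|->]; first by lia.
by split; [exact: conv_valid|lia].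
Qed.

End Facet.
End Homogenize.

(** * Unit vector differences obtained from exchanges *)

Section Connectivity.
Import fintype boot.finset.
Variables (R : realType) (E : finType) (M : matroid E).
Local Notation hvect := ({ffun E -> R^o} * R^o)%type.
Implicit Types (A : {set {set E}}) (B D F G I J : {set E}) (e f : E) (k : nat).
Implicit Types (U W : {vspace hvect}).
Local Notation u := (unitv R).

Definition parallel_in W D := forall e f, e \in D -> f \in D -> u e - u f \in W.

Lemma exchange_parallel W B e f : e \in B -> f \notin B ->
    vertex R B \in W -> vertex R (f |: (B :\ e)) \in W -> u f - u e \in W.
Proof.
move=> eB fB hB hB'; have := rpredB hB' hB; rewrite !vertexE.
have fBe : f \notin B :\ e by rewrite inE (negbTE fB) andbF.
rewrite (big_setU1 _ fBe) /=.
by rewrite (big_setD1 e eB) /= opprD addrACA subrr addr0 opprD addrACA subrr addr0.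
Qed.

(** Otherwise the elements [x] with [u e - u x] in [W] form a set that no exchange
    crosses, and this set together with its complement is a separation. *)
Lemma fiber_parallel W F G k :
    F \subset G -> (rank M F < k <= rank M G)%N ->
    (forall e, e \in G :\: F -> rank M F < rank M (e |: F))%N ->
    (forall D D', D :|: D' = G :\: F -> [disjoint D & D'] ->
       D != finset.set0 -> D' != finset.set0 -> k = rank M G ->
       rank M (F :|: D) + rank M (F :|: D') = k + rank M F -> False)%N ->
    (vspan R (fiber M F G k) <= W)%VS ->
  parallel_in W (G :\: F).
Proof.
move=> FG kG closedF insep /vspan_subP fW e f eGF fGF.
have [//|ef] := boolP (u e - u f \in W).
pose D := [set x in G :\: F | u e - u x \in W].
have DGF : D \subset G :\: F by apply/subsetP => x; rewrite inE => /andP[].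
have eD : e \in D by rewrite inE eGF subrr rpred0.
have fD' : f \in (G :\: F) :\: D by rewrite in_setD fGF andbT inE fGF.
have DD' : D :|: (G :\: F) :\: D = G :\: F.
  by rewrite -{2}(setID (G :\: F) D) (setIidPr DGF).
have disj : [disjoint D & (G :\: F) :\: D].
  by rewrite disjoint_sym disjoints_subset setDE subsetIr.
have ltF (C : {set E}) x : C \subset G :\: F -> x \in C -> (rank M F < rank M (F :|: C))%N.
  move=> CGF xC; apply: leq_trans (closedF x (subsetP CGF x xC)) _.
  by apply: rankS; rewrite setUC; apply: setUS; rewrite sub1set.
have [] := @exchange_closed_split E M F G k D ((G :\: F) :\: D) => //.
- exact: ltF eD.
- by apply: ltF fD'; apply: subsetDl.
- move=> B x y hB xB yB xF yF hB'.
  have uyx : u y - u x \in W by apply: exchange_parallel xB yB _ _; apply: fW.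
  have xG : x \in G by have /fiberP[_ BG _ _] := hB; apply: (subsetP BG).
  have yG : y \in G by have /fiberP[_ BG _ _] := hB'; apply: (subsetP BG); rewrite setU11.
  rewrite !inE xF yF xG yG /=.
  by rewrite -[u e - u x](subrKA (u y)) addrC rpredDl.
- move=> kr sumr; case: (insep D ((G :\: F) :\: D)) => //; apply/set0Pn; [by exists e|by exists f].
Qed.

Lemma sum_parallel W D I f : parallel_in W D -> I \subset D -> f \in D ->
  \sum_(e in I) u e - #|I|%:R *: u f \in W.
Proof.
move=> par ID fD; rewrite scaler_nat -sumr_const -sumrB.
by apply: rpred_sum => e eI; apply: par => //; apply: (subsetP ID).
Qed.

(** The lifts of two sets of different sizes differ, up to differences of unit
    vectors, by a nonzero multiple of one unit vector. *)
Lemma parallel_full W I J : parallel_in W [set: E] ->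
  vertex R I \in W -> vertex R J \in W -> (#|I| < #|J|)%N -> W = fullv.
Proof.
move=> par hI hJ IJ; have /card_gt0P[f fJ] : (0 < #|J|)%N by apply: leq_ltn_trans IJ.
have sumP (C : {set E}) := sum_parallel par (subsetT C) (in_setT f).
have hf : u f \in W.
  have cN0 : (#|J|%:R - #|I|%:R : R) != 0 by rewrite subr_eq0 eqr_nat gtn_eqF.
  suff : (#|J|%:R - #|I|%:R : R) *: u f \in W by rewrite rpredZeq (negbTE cN0).
  have cancel_sums (x y z v w : hvect) :
      v - w = (x + z) - (y + z) - ((x - v) - (y - w)).
    by rewrite [- (y + z)]opprD addrACA subrr addr0 !opprB addrA subrKA addrC subrKA.
  rewrite scalerBl (cancel_sums (\sum_(e in J) u e) (\sum_(e in I) u e) (apex R E)).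
  by rewrite -!vertexE; exact: rpredB (rpredB hJ hI) (rpredB (sumP J) (sumP I)).
have hu e : u e \in W.
  by rewrite -[u e](subrK (u f)) rpredD // par ?in_setT.
apply: unitv_full => //; have -> : apex R E = vertex R I - \sum_(e in I) u e.
  by rewrite vertexE addrC addKr.
by rewrite rpredB // rpred_sum.
Qed.

Hypothesis M_loopless : loopless M.

(** A proper truncation of a loopless matroid is connected. *)
Lemma parallel_truncation W G k : (0 < k < rank M G)%N ->
  (vspan R (fiber M finset.set0 G k) <= W)%VS -> parallel_in W G.
Proof.
move=> /andP[k0 kG] fW; rewrite -[G]setD0.
apply: fiber_parallel fW; rewrite ?sub0set ?rank0 ?k0 ?(ltnW kG) //.
  move=> e _; rewrite setU0; apply: leq_trans (indep_leq_rank _ (subxx _)).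
    by rewrite cards1.
  by have := M_loopless e; rewrite negbK.
by move=> D D' _ _ _ _ kE; rewrite kE ltnn in kG.
Qed.

Lemma truncation_full W k : (0 < k < rank M [set: E])%N ->
  (vspan R (fiber M finset.set0 [set: E] k) <= W)%VS ->
  (exists2 I, vertex R I \in W & #|I| != k) -> W = fullv.
Proof.
move=> k0r kW [I IW Ik].
have [|J hJ] := @exists_fiber _ M finset.set0 [set: E] k (sub0set _).
  by rewrite rank0; lia.
have JW : vertex R J \in W by have /vspan_subP := kW; apply.
have /fiberP[_ _ kJ _] := hJ.
have par : parallel_in W [set: E] by apply: parallel_truncation kW; lia.
by move: Ik; rewrite neq_ltn -kJ => /orP[]; [apply: parallel_full IW JW|apply: parallel_full JW IW].
Qed.

End Connectivity.

(** * The rank inequality on a slice of constant cardinality *)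

Section RankFacet.
Import fintype boot.finset.
Variables (R : realType) (E : finType) (M : matroid E).
Implicit Types (F I : {set E}) (k : nat).

Lemma sum_mem (F I : {set E}) :
  \sum_(e in I) (e \in F)%:R = #|I :&: F|%:R :> R.
Proof.
rewrite -sum1_card natr_sum big_mkcond [RHS]big_mkcond; apply: eq_bigr => e _.
by rewrite in_setI; case: (e \in I); case: (e \in F).
Qed.

Lemma rank_valid F k I : I \in fiber M finset.set0 [set: E] k ->
  \sum_(e in I) (e \in F)%:R <= (rank M F)%:R :> R.
Proof. by move=> /fiberP[hI _ _ _]; rewrite sum_mem ler_nat cardI_leq_rank. Qed.

Lemma tight_rank F k :
  tight (fiber M finset.set0 [set: E] k) (fun e => (e \in F)%:R : R) (rank M F)%:R =
  fiber M F [set: E] k.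
Proof.
apply/setP => I; rewrite !inE sum_mem eqr_nat setI0 cards0 rank0 eqxx andbT.
by rewrite -!andbA.
Qed.

End RankFacet.

(** * The rank induced forbidden set inequality *)

Section RankInducedForbiddenSet.
Import fintype boot.finset.
Variables (R : realType) (E : finType) (M : matroid E).
Variables (c : seq nat) (F : {set E}) (p q : nat).
Local Notation hvect := ({ffun E -> R^o} * R^o)%type.
Local Notation u := (unitv R).
Local Notation r := (rank M F).
Implicit Types (U W : {vspace hvect}) (e f : E) (I J D G : {set E}) (k : nat).
Implicit Types (a : E -> R).
Hypotheses (p_lt : (p < r)%N) (lt_q : (r < q)%N).
Hypothesis c_gap : forall k, k \in c -> (k <= p)%N || (q <= k)%N.

Definition feasible := [set I in indep M | #|I| \in c].

Definition rif_coef e : R := if e \in F then q%:R - r%:R else - (r%:R - p%:R).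

Lemma rif_sum I :
  \sum_(e in I) rif_coef e = ((q - r) * #|I :&: F|)%:R - ((r - p) * #|I :\: F|)%:R.
Proof.
rewrite (big_setID F) /= (eq_bigr (fun=> q%:R - r%:R)); last first.
  by move=> e; rewrite inE /rif_coef => /andP[_ ->].
rewrite [X in _ + X](eq_bigr (fun=> - (r%:R - p%:R))); last first.
  by move=> e; rewrite inE /rif_coef => /andP[/negbTE->].
by rewrite !sumr_const mulNrn !natrM !mulr_natr !natrB // ltnW.
Qed.

(** Moving the negative terms across leaves natural numbers on both sides. *)
Lemma rif_le I :
  (\sum_(e in I) rif_coef e <= p%:R * (q%:R - r%:R)) =
  ((q - r) * #|I :&: F| <= p * (q - r) + (r - p) * #|I :\: F|)%N.
Proof. by rewrite rif_sum lerBlDr -(natrB _ (ltnW lt_q)) -natrM -natrD ler_nat. Qed.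

Lemma rif_eq I :
  (\sum_(e in I) rif_coef e == p%:R * (q%:R - r%:R)) =
  ((q - r) * #|I :&: F| == p * (q - r) + (r - p) * #|I :\: F|)%N.
Proof. by rewrite rif_sum subr_eq -(natrB _ (ltnW lt_q)) -natrM -natrD eqr_nat. Qed.

Lemma rif_valid I : I \in feasible ->
  \sum_(e in I) rif_coef e <= p%:R * (q%:R - r%:R).
Proof.
rewrite inE => /andP[hI /c_gap Ic]; rewrite rif_le.
have := cardI_leq_rank F hI; have := cardsID F I.
move: #|I :&: F| #|I :\: F| #|I| Ic => i j n Ic eqn ir.
by case/orP: Ic; nia.
Qed.

Hypotheses (p_in : p \in c) (q_in : q \in c).

Lemma tight_feasible :
  tight feasible rif_coef (p%:R * (q%:R - r%:R)) =
  fiber M finset.set0 F p :|: fiber M F [set: E] q.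
Proof.
apply/setP => I; rewrite !inE rif_eq subsetT setI0 cards0 rank0 eqxx andbT /=.
have [hI|] //= := boolP (I \in indep M).
have := cardI_leq_rank F hI; have IE := cardsID F I.
have -> : (I \subset F) = (#|I :\: F| == 0)%N by rewrite cards_eq0 setD_eq0.
have [/c_gap|Ic] := boolP (#|I| \in c).
  move: #|I :&: F| #|I :\: F| #|I| IE => i j n IE Ic ir /=.
  rewrite !(andbC _ (_ == p)) (andbC _ (_ == r)).
  apply/eqP/idP => [sl|].
    by case/orP: Ic => Ic; nia.
  by case/orP=> /andP[/eqP h1 /eqP h2]; nia.
symmetry; apply/negbTE; apply: contra Ic => /=.
by case/orP => /andP[] => [_ /eqP->|/eqP->].
Qed.

Hypothesis c_rank : forall k, k \in c -> (k <= rank M [set: E])%N.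
Hypothesis M_loopless : loopless M.

Lemma sub_fiber_feasible D G k : k \in c -> fiber M D G k \subset feasible.
Proof.
by move=> kc; apply/subsetP => I /fiberP[hI _ kI _]; rewrite inE hI kI.
Qed.

(** Adding the origin to the slice of cardinality [q] adds one dimension.  If [c]
    has a further cardinality then [q] is below the rank of [M], and the slice
    with the origin already spans everything. *)
Lemma dim_feasible0 : p = 0%N ->
  \dim (vspan R feasible) = (\dim (vspan R (fiber M finset.set0 [set: E] q))).+1.
Proof.
move=> p0; have q0 : (0 < q)%N by apply: leq_ltn_trans lt_q.
have qP I : I \in fiber M finset.set0 [set: E] q -> #|I| = q by case/fiberP.
rewrite -(dim_add_line (apex_notin R q0 qP)); congr (\dim _).
set W := (_ + _)%VS.
have Wsub : (W <= vspan R feasible)%VS.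
  rewrite subv_add vspanS ?sub_fiber_feasible // -memvE -vertex0 mem_vspan //.
  by rewrite inE indep0 cards0 -p0.
have [/allP c2|/allPn[k kc]] := boolP (all (fun k => (k == 0%N) || (k == q)) c).
  apply/eqP; rewrite eqEsubv Wsub andbT /W -vspan_set0U; apply: vspanS.
  apply/subsetP => I; rewrite inE => /andP[hI /c2 /orP[]].
    by rewrite cards_eq0 => /eqP->; rewrite setU11.
  move=> /eqP Iq; rewrite inE; apply/orP; right.
  by apply/fiberP; rewrite subsetT setI0 cards0 rank0.
rewrite negb_or => /andP[k0 kq].
suff Wfull : W = fullv by apply/eqP; rewrite eqEsubv Wsub Wfull subvf.
have := c_gap kc; have := c_rank kc; rewrite p0 => kr kpq.
apply: (@truncation_full _ _ M M_loopless W q); first by lia.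
  exact: addvSl.
exists finset.set0; first by rewrite vertex0 memvE addvSr.
by rewrite cards0 eq_sym -lt0n.
Qed.

Lemma dim_tight0 : p = 0%N ->
  \dim (vspan R (tight feasible rif_coef (p%:R * (q%:R - r%:R)))) =
  (\dim (vspan R (fiber M F [set: E] q))).+1.
Proof.
move=> p0; have q0 : (0 < q)%N by apply: leq_ltn_trans lt_q.
have qP I : I \in fiber M F [set: E] q -> #|I| = q by case/fiberP.
rewrite tight_feasible -(dim_add_line (apex_notin R q0 qP)) -vspan_set0U.
congr (\dim (vspan R (_ :|: _))); apply/setP => I; rewrite in_set1 p0.
apply/fiberP/eqP => [[_ _ /eqP]|->]; first by rewrite cards_eq0 => /eqP.
by rewrite indep0 sub0set setI0 cards0 rank0.
Qed.

Local Notation tightF := (vspan R (tight feasible rif_coef (p%:R * (q%:R - r%:R)))).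

Lemma feasible_fullv : (0 < p)%N -> vspan R feasible = fullv.
Proof.
move=> p0; have qr := c_rank q_in.
have [|J /fiberP[hJ _ Jq _]] := @exists_fiber _ M F [set: E] q (subsetT _).
  by rewrite (ltnW lt_q) qr.
apply: (@truncation_full _ _ M M_loopless _ p); first by lia.
  by apply: vspanS; apply: sub_fiber_feasible.
exists J; first by apply: mem_vspan; rewrite inE hJ Jq.
by rewrite Jq gtn_eqF //; lia.
Qed.

Lemma coef_q_neq0 : q%:R - r%:R != 0 :> R.
Proof. by rewrite subr_eq0 eqr_nat gtn_eqF. Qed.

(** One unit vector [u e] with [e] in [F], added to the span of the tight
    vertices, yields everything: first the other unit vectors in [F], then
    [(0, 1)] from a tight set inside [F], then the unit vectors outside [F] from
    a tight set of size [q].  So the tight vertices span a hyperplane. *)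
Lemma facet_sufficient : (0 < p)%N -> closed_set M F ->
    kinseparable M q (~: F) \/ (q < rank M [set: E])%N ->
  \dim (vspan R feasible) = (\dim tightF).+1.
Proof.
move=> p0 closedF sepF; rewrite feasible_fullv //.
have qr := c_rank q_in.
have /card_gt0P[e eF] : (0 < #|F|)%N.
  by have [I [_ IF Ir]] := exists_basis M F; have := subset_leq_card IF; lia.
have eN : u e \notin tightF.
  apply: contra coef_q_neq0 => /(lform_sub (tight_ker _ _ _)).
  by rewrite lform_unitv /rif_coef eF => ->.
rewrite -(dim_add_line eN); congr (\dim _); symmetry.
set W := (_ + _)%VS.
have tightW : (tightF <= W)%VS by apply: addvSl.
have eW : u e \in W by rewrite memvE addvSr.
have pW : (vspan R (fiber M finset.set0 F p) <= W)%VS.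
  by apply: subv_trans tightW; rewrite tight_feasible vspanS ?subsetUl.
have qW : (vspan R (fiber M F [set: E] q) <= W)%VS.
  by apply: subv_trans tightW; rewrite tight_feasible vspanS ?subsetUr.
have parF : parallel_in W F by apply: (parallel_truncation M_loopless) pW; rewrite p0.
have parFc : parallel_in W (~: F).
  rewrite -setTD; apply: fiber_parallel qW => //.
  - by rewrite lt_q.
  - by move=> x; rewrite setTD inE => /closedF.
  move=> D D' DD' disj D0 D'0 qE sumr; case: sepF => [|]; last by rewrite qE ltnn.
  case; exists D, D'; split=> //; first by rewrite DD' setTD.
  rewrite setTD in DD'; rewrite /krank (setC_part DD' disj) setCK.
  rewrite setUC in DD'; rewrite (setC_part DD') 1?disjoint_sym //.
  lia.
have hF f : f \in F -> u f \in W.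
  by move=> fF; rewrite -[u f](subrK (u e)) rpredD // parF.
have apexW : apex R E \in W.
  have [|I hI] := @exists_fiber _ M finset.set0 F p (sub0set _); first by rewrite rank0 leq0n ltnW.
  have -> : apex R E = vertex R I - \sum_(f in I) u f by rewrite vertexE addrC addKr.
  have /fiberP[_ IF _ _] := hI.
  rewrite rpredB //; first by have /vspan_subP := pW; apply.
  by apply: rpred_sum => f fI; apply/hF/(subsetP IF).
have [|J hJ] := @exists_fiber _ M F [set: E] q (subsetT _); first by rewrite (ltnW lt_q) qr.
have /fiberP[_ _ Jq Jr] := hJ.
(* J has q - r > 0 elements outside F. *)
have JF : (0 < #|J :\: F|)%N by have := cardsID F J; lia.
have /card_gt0P[f fJF] := JF.
have fF : f \in ~: F by move: fJF; rewrite !inE => /andP[].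
have fW : u f \in W.
  have JN0 : #|J :\: F|%:R != 0 :> R by rewrite pnatr_eq0 -lt0n.
  suff : (#|J :\: F|%:R : R) *: u f \in W by rewrite rpredZeq (negbTE JN0).
  have JFc : J :\: F \subset ~: F by rewrite setDE subsetIr.
  have sumW : \sum_(x in J :\: F) u x \in W.
    have -> : \sum_(x in J :\: F) u x =
        vertex R J - (\sum_(x in J :&: F) u x + apex R E).
      rewrite vertexE [\sum_(x in J) _](big_setID F) /=.
      by rewrite [X in X + apex R E]addrC -[X in X - _]addrA addrK.
    rewrite rpredB ?rpredD //; first by have /vspan_subP := qW; apply.
    by apply: rpred_sum => x; rewrite inE => /andP[_ /hF].
  by have := rpredB sumW (sum_parallel parFc JFc fF); rewrite opprB addrC subrK.
apply: unitv_full => // x; have [/hF //|xF] := boolP (x \in F).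
by rewrite -[u x](subrK (u f)) rpredD // parFc // inE.
Qed.

(** If the tight vertices span a hyperplane, any linear form vanishing on them is
    a multiple of the one given by the inequality, so it cannot vanish at [u f]
    with [f] in [F] without vanishing at every [u e] with [e] outside [F].
    An [e] in the closure of [F] gives the form [x_e]; a separation [G1], [G2] of
    the complement gives [s2 * x(G1) - s1 * x(G2)]. *)
Lemma facet_necessary : (0 < p)%N -> \dim (vspan R feasible) = (\dim tightF).+1 ->
  closed_set M F /\ kinseparable M q (~: F).
Proof.
move=> p0; rewrite feasible_fullv // => dimT.
have /card_gt0P[f fF] : (0 < #|F|)%N.
  by have [I [_ IF Ir]] := exists_basis M F; have := subset_leq_card IF; lia.
have key e a : e \notin F -> a f = 0 -> a e != 0 ->
    (forall I, I \in fiber M finset.set0 F p -> \sum_(x in I) a x = 0) ->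
    (forall I, I \in fiber M F [set: E] q -> \sum_(x in I) a x = 0) -> False.
  move=> eF af ae ap aq.
  (* The coefficients are chosen so that the form of the inequality vanishes. *)
  pose w : hvect := (q%:R - r%:R : R) *: u e + (r%:R - p%:R : R) *: u f.
  have tight_a : (tightF <= lker (linfun (lform a 0)))%VS.
    apply/vspan_kerP => I; rewrite tight_feasible addr0 => /setUP[/ap|/aq] //.
  have wN : w \notin tightF.
    apply/negP => /(lform_sub tight_a) /eqP.
    rewrite raddfD /= !linearZ /= !lform_unitv af scaler0 addr0.
    by rewrite /GRing.scale /= mulf_eq0 (negbTE coef_q_neq0) (negbTE ae).
  have full : (tightF + <[w]>)%VS = fullv.
    by apply/eqP; rewrite eqEdim subvf dim_add_line // dimT leqnn.
  have : u f \in (tightF + <[w]>)%VS by rewrite full memvf.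
  move/(@lform_sub _ _ rif_coef (- (p%:R * (q%:R - r%:R)))) => h.
  have /eqP : lform rif_coef (- (p%:R * (q%:R - r%:R))) (u f) = 0.
    apply: h; rewrite subv_add tight_ker -memvE memv_ker lfunE /=.
    rewrite raddfD /= !linearZ /= !lform_unitv /rif_coef fF (negbTE eF).
    by rewrite /GRing.scale /= mulrN mulrC addrC subrr.
  by rewrite lform_unitv /rif_coef fF (negbTE coef_q_neq0).
have closedF : closed_set M F.
  move=> e eF; rewrite ltnNge; apply/negP => re.
  apply: (key e (fun x => (x == e)%:R)) => //.
  - by case: eqVneq => // fe; move: eF; rewrite -fe fF.
  - by rewrite eqxx oner_eq0.
  - move=> I /fiberP[_ /subsetP IF _ _]; apply: big1 => x /IF xF.
    by case: eqVneq => // xe; move: eF; rewrite -xe xF.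
  move=> I /fiberP[hI _ _ rI]; apply: big1 => x xI; case: eqVneq => // xe.
  (* With e, the set I would have r + 1 elements in a set of rank r. *)
  rewrite xe in xI; have := cardI_leq_rank (e |: F) hI.
  have : e |: (I :&: F) \subset I :&: (e |: F).
    by rewrite subUset sub1set !inE xI eqxx /= setIS ?subsetUr.
  by move=> /subset_leq_card; rewrite cardsU1 inE (negbTE eF) andbF /= rI; lia.
split=> // -[G1 [G2 [GF disj /set0Pn[e eG1] /set0Pn[g gG2] krE]]].
have disj' : [disjoint G2 & G1] by rewrite disjoint_sym.
have C1 := setC_part GF disj.
have C2 : ~: G2 = F :|: G1 by apply: setC_part disj'; rewrite setUC.
move: krE; rewrite /krank C1 C2 setCK => krE.
have G1F : [disjoint G1 & F] by rewrite disjoints_subset -GF subsetUl.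
have G2F : [disjoint G2 & F] by rewrite disjoints_subset -GF subsetUr.
have r2 : (r < rank M (F :|: G2))%N.
  have gF : g \notin F by rewrite (disjointFr G2F gG2).
  apply: leq_trans (closedF g gF) (rankS M _).
  by rewrite setUC setUS // sub1set.
pose s1 := (rank M (F :|: G1) - r)%N; pose s2 := (rank M (F :|: G2) - r)%N.
apply: (key e (fun x => if x \in G1 then s2%:R else if x \in G2 then - s1%:R else 0)).
- by rewrite (disjointFr G1F eG1).
- by rewrite (disjointFl G1F fF) (disjointFl G2F fF).
- by rewrite eG1 pnatr_eq0 -lt0n subn_gt0.
- move=> I /fiberP[_ /subsetP IF _ _]; apply: big1 => x /IF xF.
  by rewrite (disjointFl G1F xF) (disjointFl G2F xF).
move=> I /fiberP[hI _ Iq Ir].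
have h1 := cardI_leq_rank (F :|: G1) hI; have h2 := cardI_leq_rank (F :|: G2) hI.
have hq : #|I :&: (F :|: (G1 :|: G2))| = q by rewrite GF setUCr setIT.
move: h1 h2 hq; rewrite !cardsI_disjointU //; last first.
  by rewrite GF disjoints_subset subxx.
rewrite Ir => h1 h2 hq.
(* The two rank bounds add up to the size of I outside F: both are attained. *)
have k1 : #|I :&: G1| = s1 by rewrite /s1; lia.
have k2 : #|I :&: G2| = s2 by rewrite /s2; lia.
rewrite (big_setID G1) /= (eq_bigr (fun=> s2%:R)); last by move=> x /setIP[_ ->].
rewrite [\sum_(x in I :\: G1) _](big_setID G2) /= [X in _ + (X + _)](eq_bigr (fun=> - s1%:R)); last first.
  by move=> x; rewrite !inE => /andP[/andP[/negbTE-> _] ->].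
rewrite [X in _ + (_ + X)]big1 ?addr0; last first.
  by move=> x; rewrite !inE => /and3P[/negbTE-> /negbTE-> _].
have -> : (I :\: G1) :&: G2 = I :&: G2.
  apply/setP => x; rewrite !inE; case: (boolP (x \in G2)) => xG; rewrite ?andbF //.
  by rewrite (disjointFr disj' xG).
by rewrite !sumr_const k1 k2 mulNrn -!mulrnA mulnC subrr.
Qed.

End RankInducedForbiddenSet.

(** * The facet criterion *)

(* The sequence c is indexed from 0 here, so that c_p and c_{p+1} are
   nth 0 c p and nth 0 c p.+1 with p.+1 < m. *)
Theorem theorem2p8 (R : realType) (E : finType) (M : matroid E)
    (m : nat) (c : m.-tuple nat) (F : {set E}) (p : nat)
    (M_loopless : loopless M)
    (m_ge2 : (2 <= m)%N)
    (c_incr : sorted ltn c)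
    (c_le_rank : (last 0 c <= rank M [set: E])%N)
    (p_lt : (p.+1 < m)%N)
    (F_gt : (nth 0 c p < rank M F)%N)
    (F_lt : (rank M F < nth 0 c p.+1)%N) :
  let cp := nth 0%N c p in
  let cq := nth 0%N c p.+1 in
  let r := rank M F in
  defines_facet (card_constrained_polytope R M c)
    (fun x => (cq%:R - r%:R) * coord_sum x F
              - (r%:R - cp%:R) * coord_sum x (~: F))
    (cp%:R * (cq%:R - r%:R))
  <->
  (cp = nth 0%N c 0 /\ cp = 0%N /\
   defines_facet (uniform_card_polytope R M cq)
     (fun x => coord_sum x F) r%:R)
  \/
  ((0 < cp)%N /\ closed_set M F /\
   (kinseparable M cq (~: F) \/ (cq < rank M [set: E])%N)).
Proof.
move=> cp cq r.
have p_lt' : (p < m)%N by apply: ltnW.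
have cp_in : cp \in (c : seq nat) by rewrite mem_nth ?size_tuple.
have cq_in : cq \in (c : seq nat) by rewrite mem_nth ?size_tuple.
have c_mono i j : (i <= j < m)%N -> (nth 0%N c i <= nth 0%N c j)%N.
  have c_leq : sorted leq c by apply: sub_sorted c_incr => x y /ltnW.
  case/andP=> ij jm; apply: (sorted_leq_nth leq_trans leqnn 0%N c_leq) => //;
    by rewrite inE size_tuple ?(leq_ltn_trans ij).
have c_gap k : k \in (c : seq nat) -> (k <= cp)%N || (cq <= k)%N.
  move=> /(nthP 0%N)[i]; rewrite size_tuple => im <-.
  by have [ip|pi] := leqP i p; apply/orP; [left|right]; apply: c_mono; rewrite ?ip ?pi.
have c_rank k : k \in (c : seq nat) -> (k <= rank M [set: E])%N.
  move=> /(nthP 0%N)[i]; rewrite size_tuple => im <-.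
  by apply: leq_trans c_le_rank; rewrite -nth_last size_tuple c_mono; lia.
have P_vertices x : (exists I, [/\ I \in indep M, #|I| \in (c : seq nat) & x = chi R I]) <->
    exists2 I, I \in feasible M c & x = chi R I.
  split=> [[I [hI cI ->]]|[I]]; first by exists I; rewrite // inE hI.
  by rewrite inE => /andP[hI cI] ->; exists I.
have Pq_vertices x : (exists I, [/\ I \in indep M, #|I| = cq & x = chi R I]) <->
    exists2 I, I \in fiber M finset.set0 [set: E] cq & x = chi R I.
  split=> [[I [hI cI ->]]|[I /fiberP[hI _ cI _] ->]]; last by exists I.
  exists I => //; apply/fiberP; split=> //.
  by rewrite finset.setI0 cards0 rank0.
have rif_form x : (cq%:R - r%:R) * coord_sum x F - (r%:R - cp%:R) * coord_sum x (~: F) =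
    \sum_e rif_coef R M F cp cq e * x e.
  rewrite /coord_sum !mulr_sumr -sumrN [RHS](bigID (mem F)) /=; congr (_ + _).
    by apply: eq_bigr => e eF; rewrite /rif_coef eF.
  apply: eq_big => e; first by rewrite finset.in_setC.
  by rewrite finset.in_setC /rif_coef => /negbTE->; rewrite mulNr.
have rank_form (x : {ffun E -> R^o}) : coord_sum x F = \sum_e (e \in F)%:R * x e.
  rewrite /coord_sum big_mkcond; apply: eq_bigr => e _.
  by case: (e \in F); rewrite ?mul1r ?mul0r.
have facetP := defines_facetE P_vertices rif_form (rif_valid R F_gt F_lt c_gap).
have facetQ := defines_facetE Pq_vertices rank_form (@rank_valid R E M F cq).
rewrite /card_constrained_polytope /uniform_card_polytope facetP facetQ tight_rank.
have [cp0|cp_gt0] := posnP cp.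
  rewrite (dim_feasible0 _ F_gt F_lt c_gap cp_in cq_in c_rank M_loopless cp0).
  rewrite (dim_tight0 _ F_gt F_lt c_gap cp_in cq_in cp0).
  split=> [[->]|[[_ [_ ->]] //|[]//]]; left; split=> //.
  rewrite cp0; apply/esym/eqP; rewrite -leqn0.
  by apply: leq_trans (c_mono 0%N p _) _; rewrite ?p_lt' // -/cp cp0.
split=> [|[[_ [cp0]]|[_ [closedF sepF]]]].
- move/(facet_necessary F_gt F_lt c_gap cp_in cq_in c_rank M_loopless cp_gt0).
  by case=> closedF insepF; right; do 2?split=> //; left.
- by rewrite cp0 in cp_gt0.
- exact: facet_sufficient.
Qed.
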